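(* Let $m,n,p\ge 1$ and let $\{\boldsymbol{Y}_t\}_{t\in\mathbb{Z}}$ be the MAT-INAR($p$) process $$\boldsymbol{Y}_t=\boldsymbol{A}_1\circ_L\boldsymbol{Y}_{t-1}\circ_R\boldsymbol{B}_1^{\top}+\cdots+\boldsymbol{A}_p\circ_L\boldsymbol{Y}_{t-p}\circ_R\boldsymbol{B}_p^{\top}+\boldsymbol{\mathcal{E}}_t,\qquad t\in\mathbb{Z},$$ with coefficient matrices $\boldsymbol{A}_l\in[0,1]^{m\times m}$, $\boldsymbol{B}_l\in[0,1]^{n\times n}$ ($l=1,\dots,p$). Let $\boldsymbol{\mathcal{A}}$ be the $mnp\times mnp$ companion matrix whose $mn\times mn$ blocks are $\boldsymbol{\mathcal{A}}_{1,j}=\boldsymbol{B}_j\otimes\boldsymbol{A}_j$ for $1\le j\le p$, $\boldsymbol{\mathcal{A}}_{i,i-1}=\boldsymbol{I}_{mn}$ for $2\le i\le p$, and all other blocks equal to zero. If the spectral radius satisfies $\rho(\boldsymbol{\mathcal{A}})<1$, then the MAT-INAR($p$) process is stationary and causal.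
   Context: Binomial thinning: for $a\in[0,1]$ and an $\mathbb{N}_0$-valued random variable $y$, $a\circ y=\sum_{s=1}^{y}B_a^{(s)}$ (and $a\circ y=0$ if $y=0$), where $(B_a^{(s)})_{s\ge1}$ are i.i.d. Bernoulli($a$) variables (the counting series). Matricial thinning operators: for an $\mathbb{N}_0$-valued $m\times n$ matrix $\boldsymbol{Y}=(y_{i,j})$, $\boldsymbol{A}=(a_{i,j})\in[0,1]^{m\times m}$ and $\boldsymbol{B}=(b_{i,j})\in[0,1]^{n\times n}$, define the $m\times n$ matrices $(\boldsymbol{A}\circ_L\boldsymbol{Y})_{i,j}=\sum_{k=1}^m a_{i,k}\circ y_{k,j}$ and $(\boldsymbol{Y}\circ_R\boldsymbol{B})_{i,j}=\sum_{k=1}^n b_{k,j}\circ y_{i,k}$, all thinnings being performed with independent counting series. $\boldsymbol{A}\circ_L\boldsymbol{Y}\circ_R\boldsymbol{B}^{\top}$ is read as $(\boldsymbol{A}\circ_L\boldsymbol{Y})\circ_R\boldsymbol{B}^{\top}$. MAT-INAR($p$) assumptions: $\boldsymbol{Y}_t$ is $\mathbb{N}_0^{m\times n}$-valued; $\boldsymbol{A}_l\in[0,1]^{m\times m}$ with Frobenius norm $\|\boldsymbol{A}_l\|_F=1$ (identifiability convention), $\boldsymbol{B}_l\in[0,1]^{n\times n}$; $\{\boldsymbol{\mathcal{E}}_t\}$ is an i.i.d. sequence of random $m\times n$ matrices with nonnegative integer entries, mean matrix $\boldsymbol{\Lambda}$ and $E(\boldsymbol{\mathcal{E}}_t\boldsymbol{\mathcal{E}}_t^{\top})<\infty$;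 for each $t$, $\boldsymbol{\mathcal{E}}_t$ is independent of the counting series in $\boldsymbol{A}_l\circ_L\boldsymbol{Y}_{t-l}\circ_R\boldsymbol{B}_l^{\top}$ and of $\boldsymbol{Y}_{t-s}$, $s\ge1$, and the counting series used at time $t$ are independent of $\boldsymbol{Y}_{t-s}$, $s\ge1$. ''Stationary'' means that the recursion admits a strictly stationary solution; ''causal'' means that $\boldsymbol{Y}_t$ is determined by (measurable with respect to) the innovations and counting series at times up to $t$. $\otimes$ is the Kronecker product; $\rho(\cdot)$ is the maximum modulus of the eigenvalues. *)

(* Defs.v *)
From HB Require Import structures.
From mathcomp Require Import all_boot all_order all_algebra.
From mathcomp Require Import all_classical all_reals all_analysis.
From mathcomp Require Import complex mxtens.

Set Implicit Arguments.
Unset Strict Implicit.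
Unset Printing Implicit Defensive.

Import Order.TTheory GRing.Theory Num.Theory.
Import numFieldNormedType.Exports.

Local Open Scope classical_set_scope.
Local Open Scope ring_scope.

(* 'M[nat]_(m, n) is countable, hence carries the discrete sigma-algebra. *)
HB.instance Definition _ (m n : nat) :=
  @isMeasurable.Build default_measure_display 'M[nat]_(m, n)
    discrete_measurable discrete_measurable0
    discrete_measurableC discrete_measurableU.

Section LinearAlgebra.
Context {R : realType}.

Definition frobenius_norm (m n : nat) (M : 'M[R]_(m, n)) : R :=
  Num.sqrt (\sum_i \sum_j M i j ^+ 2).

(* For a matrix of positive size the spectrum is finite and nonempty, so the
   supremum is the maximum modulus of the complex eigenvalues. *)
Definition spectral_radius (N : nat) (M : 'M[R]_N) : R :=
  sup [set ComplexField.Normc.normc z |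
        z in [set z : R[i] | eigenvalue (map_mx (real_complex R) M) z]].

(* Lags and blocks are numbered from 0: A l, B l are A_{l+1}, B_{l+1}.
   tensmx ( *t ) is the Kronecker product. *)
Definition companion_block (m n p : nat) (A : 'I_p -> 'M[R]_m)
    (B : 'I_p -> 'M[R]_n) (i j : 'I_p) : 'M[R]_(n * m) :=
  if i == 0%N :> nat then B j *t A j
  else if i == j.+1 :> nat then 1%:M
  else 0.

Definition companion (m n p : nat) (A : 'I_p -> 'M[R]_m)
    (B : 'I_p -> 'M[R]_n) : 'M[R]_(\sum_(i < p) n * m) :=
  \mxblock_(i < p, j < p) companion_block A B i j.

End LinearAlgebra.

(* Realization of a o y, where b is the realized Bernoulli(a) counting series;
   the parameter a only enters through the law of b. *)
Definition thinning (b : nat -> bool) (y : nat) : nat := (\sum_(s < y) b s)%N.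

(* b i j k is the counting series of the thinning a_{i,k} o y_{k,j}. *)
Definition left_thinning (m n : nat) (b : 'I_m -> 'I_n -> 'I_m -> nat -> bool)
    (Y : 'M[nat]_(m, n)) : 'M[nat]_(m, n) :=
  \matrix_(i, j) (\sum_(k < m) thinning (b i j k) (Y k j))%N.

(* b i j k is the counting series of the thinning b_{k,j} o y_{i,k}. *)
Definition right_thinning (m n : nat) (b : 'I_m -> 'I_n -> 'I_n -> nat -> bool)
    (Y : 'M[nat]_(m, n)) : 'M[nat]_(m, n) :=
  \matrix_(i, j) (\sum_(k < n) thinning (b i j k) (Y i k))%N.

Section Probability.
Context {R : realType} {d : measure_display} {Omega : measurableType d}.
Variable P : probability Omega R.

Definition sigma_rv (d' : measure_display) (T : measurableType d')
    (X : Omega -> T) : set (set Omega) :=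
  preimage_set_system setT X measurable.

Definition independent2 (F G : set (set Omega)) : Prop :=
  forall C D, F C -> G D -> P (C `&` D) = (P C * P D)%E.

Definition mutually_independent (I : eqType) (F : I -> set (set Omega)) : Prop :=
  forall (J : seq I) (C : I -> set Omega), uniq J ->
    (forall i, i \in J -> F i (C i)) ->
    P (\bigcap_(i in [set` J]) C i) = (\prod_(i <- J) P (C i))%E.

(* Equality of all finite-dimensional laws; every set of tuples of points of
   the countable space 'M[nat]_(m, n) is measurable. *)
Definition strictly_stationary (m n : nat)
    (Y : int -> {RV P >-> 'M[nat]_(m, n)}) : Prop :=
  forall (k : nat) (t : 'I_k -> int) (h : int) (C : set ('I_k -> 'M[nat]_(m, n))),
    P [set w | C (fun r => Y (t r + h) w)] = P [set w | C (fun r => Y (t r) w)].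

Section MatInar.
Variables m n p : nat.
Variables (Lambda : 'M[R]_(m, n)) (A : 'I_p -> 'M[R]_m) (B : 'I_p -> 'M[R]_n).
Variable E : int -> {RV P >-> 'M[nat]_(m, n)}.
(* U t l (resp. V t l) is the array of counting series used at time t in the
   left (resp. right) thinning of lag l.+1. *)
Variable U : int -> 'I_p -> 'I_m -> 'I_n -> 'I_m -> nat -> {RV P >-> bool}.
Variable V : int -> 'I_p -> 'I_m -> 'I_n -> 'I_n -> nat -> {RV P >-> bool}.

(* (t, None) stands for E t; (t, Some (l, i, j, inl k, s)) for U t l i j k s;
   (t, Some (l, i, j, inr k, s)) for V t l i j k s. *)
Definition counting_index : Type := 'I_p * 'I_m * 'I_n * ('I_m + 'I_n) * nat.
Definition driver_index : Type := int * option counting_index.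

Definition driver_sigma (x : driver_index) : set (set Omega) :=
  match x with
  | (t, None) => sigma_rv (E t)
  | (t, Some (l, i, j, inl k, s)) => sigma_rv (U t l i j k s)
  | (t, Some (l, i, j, inr k, s)) => sigma_rv (V t l i j k s)
  end.

Record matinar_drivers : Prop := {
  A_itv : forall l i k, 0 <= A l i k <= 1;
  B_itv : forall l j k, 0 <= B l j k <= 1;
  A_norm : forall l, frobenius_norm (A l) = 1;
  E_identically_distributed : forall t, distribution P (E t) =1 distribution P (E 0);
  E_mean : forall t i j, ('E_P[fun w => (E t w i j)%:R] = (Lambda i j)%:E)%E;
  E_second_moment : forall t i j,
    P.-integrable setT (fun w => ((E t w *m (E t w)^T) i j)%:R%:E);
  U_bernoulli : forall t l i j k s,
    distribution P (U t l i j k s) =1 bernoulli_prob (A l i k);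
  V_bernoulli : forall t l i j k s,
    distribution P (V t l i j k s) =1 bernoulli_prob ((B l)^T k j);
  drivers_independent : mutually_independent driver_sigma
}.

Definition counting_sigma (t : int) : set (set Omega) :=
  \bigcup_c driver_sigma (t, Some c).

Definition past_sigma (Y : int -> {RV P >-> 'M[nat]_(m, n)}) (t : int)
    : set (set Omega) :=
  \bigcup_(s in [set s : int | s < t]) sigma_rv (Y s).

Definition matinar_rhs (Y : int -> Omega -> 'M[nat]_(m, n)) (t : int) (w : Omega)
    : 'M[nat]_(m, n) :=
  \sum_(l < p)
    right_thinning (fun i j k s => V t l i j k s w)
      (left_thinning (fun i j k s => U t l i j k s w) (Y (t - l.+1%:Z) w))
  + E t w.

Record matinar_process (Y : int -> {RV P >-> 'M[nat]_(m, n)}) : Prop := {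
  matinar_recursion : forall t, {ae P, forall w, Y t w = matinar_rhs Y t w};
  innovation_independent : forall t,
    independent2 (sigma_rv (E t)) <<s counting_sigma t `|` past_sigma Y t >>;
  counting_independent : forall t,
    independent2 <<s counting_sigma t >> <<s past_sigma Y t >>
}.

Definition causal (Y : int -> {RV P >-> 'M[nat]_(m, n)}) : Prop :=
  forall t, sigma_rv (Y t) `<=`
    <<s \bigcup_(x in [set x | x.1 <= t]) driver_sigma x >>.

End MatInar.
End Probability.

(* Main.v *)
(* Iterate the recursion from the zero process. Thinning is monotone, so the
   iterates increase. Their entrywise means are bounded by the nonnegative
   solution M of M = sum_l A_l M B_l^T + Lambda, which is read off the resolvent
   (1 - C)^-1 of the companion matrix C: it is entrywise nonnegative because
   1 - t C is invertible for t in [0, 1], the spectral radius being less than 1.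
   Hence the iterates are almost surely bounded and, being integers, eventually
   constant; the limit solves the recursion. It is a fixed measurable functional
   of the drivers up to time t which commutes with time shifts, and the law of
   the independent drivers is shift invariant, which gives stationarity. *)

Require Import Defs.
From HB Require Import structures.
From mathcomp Require Import all_boot all_order all_algebra.
From mathcomp Require Import all_classical all_reals all_analysis.
From mathcomp Require Import measurable_realfun complex mxtens.

Set Implicit Arguments.
Unset Strict Implicit.
Unset Printing Implicit Defensive.

Import Order.TTheory GRing.Theory Num.Theory.
Import numFieldNormedType.Exports.

Local Open Scope classical_set_scope.
Local Open Scope ring_scope.

(** * Nonnegativity of the resolvent *)

(** Minimum principle: at an index [k] where [x] is smallest and negative, the equation forces
    [x k 0] to be at least [x k 0] times a row sum of [K], which is impossible when that sum is
    below 1. *)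
Lemma subinvariant_nneg (R : realFieldType) (N : nat) (K : 'M[R]_N) (x c : 'cV[R]_N) :
  (forall i j, 0 <= K i j) -> (forall i, \sum_j K i j < 1) ->
  (forall i, 0 <= c i 0) -> x = K *m x + c -> forall i, 0 <= x i 0.
Proof.
move=> K0 K1 c0 xE i; rewrite leNgt; apply/negP => xi0.
case: (arg_minP (fun k => x k 0) (i0 := i) (P := xpredT)) => // k _ kmin.
have xk0 : x k 0 < 0 by exact: le_lt_trans (kmin i isT) xi0.
have : x k 0 * \sum_j K k j <= x k 0.
  rewrite {2}xE !mxE mulr_sumr; apply: ler_wpDr => //.
  by apply: ler_sum => j _; rewrite mulrC ler_wpM2l// kmin.
by apply/negP; rewrite -ltNge -[ltLHS]mulr1 ltr_nM2l.
Qed.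

Lemma mulmx_nneg (R : numDomainType) (a b c : nat) (M : 'M[R]_(a, b)) (x : 'M[R]_(b, c)) :
  (forall i j, 0 <= M i j) -> (forall i j, 0 <= x i j) ->
  forall i j, 0 <= (M *m x) i j.
Proof.
by move=> M0 x0 i j; rewrite mxE; apply: sumr_ge0 => k _; rewrite mulr_ge0.
Qed.

(* The entries of the resolvent are quotients of polynomials in t whose
   denominator does not vanish on the compact interval [0, 1]. *)
Lemma resolvent_bounded (R : realType) (N : nat) (M : 'M[R]_N) :
  (forall t, 0 <= t <= 1 -> 1%:M - t *: M \in unitmx) ->
  exists2 C : R, 0 < C &
    forall t, 0 <= t <= 1 -> forall i j, `|invmx (1%:M - t *: M) i j| <= C.
Proof.
move=> Mu; pose D : 'M[{poly R}]_N := 1%:M - 'X *: map_mx polyC M.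
have DE t : map_mx (horner_eval t) D = 1%:M - t *: M.
  apply/matrixP => i j; rewrite !mxE /horner_eval hornerD hornerN hornerM.
  by rewrite hornerX hornerC; case: (i == j) => /=; rewrite ?hornerE.
have norm_cont (p : {poly R}) : {within `[0, 1], continuous (fun t => `|p.[t]|)}.
  apply: continuous_subspaceT => t.
  by apply: continuous_comp; [exact: continuous_horner|exact: norm_continuous].
have [t0 t01 detmin] := EVT_min ler01 (norm_cont (\det D)).
rewrite in_itv/= in t01.
have det0 : 0 < `|(\det D).[t0]|.
  have := Mu _ t01; rewrite unitmxE unitfE -DE det_map_mx normr_gt0.
  by [].
have adjb i j : exists b, forall t, 0 <= t <= 1 -> `|(\adj D i j).[t]| <= b.
  have [c _ cmax] := EVT_max ler01 (norm_cont (\adj D i j)).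
  by exists `|(\adj D i j).[c]| => t t01'; apply: cmax; rewrite in_itv.
have /choice [b bP] : forall ij : 'I_N * 'I_N, exists b, forall t, 0 <= t <= 1 ->
    `|(\adj D ij.1 ij.2).[t]| <= b by move=> ij; exact: adjb.
have b0 ij : 0 <= b ij.
  by apply: le_trans (bP ij 0 _); rewrite ?lexx ?ler01.
(* Summing the bounds of all cofactors dominates each of them; the extra 1 keeps the constant
   positive when the sum vanishes. *)
exists (\sum_ij b ij / `|(\det D).[t0]| + 1).
  rewrite ltr_wpDl//; apply: sumr_ge0 => ij _.
  by rewrite divr_ge0// ltW.
move=> t t01' i j; rewrite /invmx Mu// mxE -DE det_map_mx -map_mx_adj mxE /horner_eval.
apply: (@le_trans _ _ (b (i, j) / `|(\det D).[t0]|)).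
  rewrite normrM normfV mulrC ler_pM ?invr_ge0//; first exact: (bP (i, j)).
  have dt : `|(\det D).[t0]| <= `|(\det D).[t]|.
    by apply: detmin; rewrite in_itv.
  by rewrite lef_pV2// posrE// (lt_le_trans det0).
rewrite (bigD1 (i, j))//= -addrA lerDl addr_ge0// sumr_ge0// => ij _.
by rewrite divr_ge0// ltW.
Qed.

(* Nonnegativity of the resolvent propagates from t' to t when t - t' is small,
   with a uniform step size: (1 - t M) x = c reads x = (t - t') R(t') M x + R(t') c. *)
Lemma resolvent_nneg (R : realType) (N : nat) (M : 'M[R]_N) :
  (forall i j, 0 <= M i j) ->
  (forall t, 0 <= t <= 1 -> 1%:M - t *: M \in unitmx) ->
  forall c : 'cV[R]_N, (forall i, 0 <= c i 0) ->
  forall i, 0 <= (invmx (1%:M - M) *m c) i 0.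
Proof.
move=> M0 Mu.
have [C C0 Cb] := resolvent_bounded Mu.
pose S := \sum_k \sum_j M k j.
have S0 : 0 <= S by apply: sumr_ge0 => k _; apply: sumr_ge0.
have CS0 : 0 <= C * S by rewrite mulr_ge0// ltW.
(* When [R(t')] is nonnegative, the row sums of [R(t') M] are at most [C * S], so a step of length
   at most [e] keeps those of [(t - t') R(t') M] below 1. *)
pose e := (C * S + 1)^-1.
have e0 : 0 < e by rewrite invr_gt0 ltr_wpDl.
have eCS : e * (C * S) < 1 by rewrite mulrC ltr_pdivrMr ?mul1r ?ltrDl// ltr_wpDl.
have step t t' : 0 <= t <= 1 -> 0 <= t' <= 1 -> 0 <= t - t' <= e ->
    (forall i j, 0 <= invmx (1%:M - t' *: M) i j) ->
    forall i j, 0 <= invmx (1%:M - t *: M) i j.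
  move=> t01 t'01 /andP[tt'0 tt'e] Rt'0 i j.
  set x := col j (invmx (1%:M - t *: M)).
  suff : forall i, 0 <= x i 0 by move=> /(_ i); rewrite mxE.
  set Rt' := invmx (1%:M - t' *: M) in Rt'0 *.
  apply: (@subinvariant_nneg _ _ ((t - t') *: (Rt' *m M)) _ (col j Rt')).
  - by move=> k l; rewrite mxE mulr_ge0// mulmx_nneg.
  - move=> k; apply: le_lt_trans eCS.
    under eq_bigr do rewrite mxE.
    rewrite -mulr_sumr ler_pM//.
      by apply: sumr_ge0 => l _; apply: mulmx_nneg.
    under eq_bigr do rewrite mxE.
    rewrite exchange_big/= mulr_sumr; apply: ler_sum => l _.
    rewrite mulr_sumr; apply: ler_sum => h _; apply: ler_wpM2r => //.
    by apply: le_trans (ler_norm _) _; exact: Cb.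
  - by move=> k; rewrite mxE.
  - have xE : (1%:M - t *: M) *m x = col j 1%:M.
      by rewrite /x !colE mulmxA mulmxV ?Mu// mul1mx.
    have RE : Rt' *m ((1%:M - t *: M) *m x) = col j Rt'.
      by rewrite xE !colE mulmxA mulmx1.
    rewrite -RE -scalemxAl -mulmxA scalemxAr -mulmxDr.
    have -> : (t - t') *: (M *m x) + (1%:M - t *: M) *m x = (1%:M - t' *: M) *m x.
      rewrite !mulmxBl -!scalemxAl scalerBl addrC addrA subrK.
      by [].
    by rewrite mulmxA mulVmx ?Mu// mul1mx.
have inv0 (k : nat) : forall t, 0 <= t <= 1 -> t <= k%:R * e ->
    forall i j, 0 <= invmx (1%:M - t *: M) i j.
  elim: k => [|k IH] t t01.
    rewrite mul0r => t0 i j.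
    have -> : t = 0 by apply/eqP; rewrite eq_le t0; case/andP: t01.
    by rewrite scale0r subr0 invmx1 mxE ler0n.
  rewrite -natr1 mulrDl mul1r => tk.
  case/andP: (t01) => t0 t1.
  (* A small [t] is reached directly from 0, since [t - e] could leave [[0, 1]]. *)
  have [te|te] := leP t e.
    apply: (step t 0) => //; rewrite ?lexx ?ler01 ?subr0 ?t0//.
    by move=> i j; rewrite scale0r subr0 invmx1 mxE ler0n.
  have t'01 : 0 <= t - e <= 1.
    by rewrite subr_ge0 (ltW te)/= lerBlDr (le_trans t1)// lerDl ltW.
  apply: (step t (t - e)) => //.
    by rewrite subKr lexx ltW.
  by apply: IH => //; rewrite lerBlDr.
move=> c c0; have := inv0 (Num.Def.archi_bound e^-1) 1.
rewrite scale1r ler01 lexx => /(_ isT) inv1.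
suff /inv1 R0 : 1 <= (Num.Def.archi_bound e^-1)%:R * e.
  by move=> i; apply: mulmx_nneg => [|k l]; [exact: R0|rewrite ord1].
rewrite -ler_pdivrMr// div1r; apply: ltW; apply: archi_boundP.
by rewrite invr_ge0 ltW.
Qed.

(** For [t] in [(0, 1]], a left kernel vector of [1%:M - t *: M] is an eigenvector of [M] for the
    value [t^-1 >= 1], beyond the spectral radius. *)
Lemma spectral_radius_lt1_unitmx (R : realType) (N : nat) (M : 'M[R]_N) :
  spectral_radius M < 1 ->
  forall t, 0 <= t <= 1 -> 1%:M - t *: M \in unitmx.
Proof.
move=> M1 t /andP[t0 t1].
have [->|tn0] := eqVneq t 0; first by rewrite scale0r subr0 unitmx1.
rewrite unitmxE unitfE; apply/negP => /det0P[v vn0 /eqP].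
rewrite mulmxBr mulmx1 -scalemxAr subr_eq0 => /eqP vE.
have tp : 0 < t by rewrite lt_neqAle eq_sym tn0.
have eM : eigenvalue M t^-1.
  apply/eigenvalueP; exists v => //.
  by rewrite {2}vE scalerA mulVf// scale1r.
suff : t^-1 <= spectral_radius M.
  by apply/negP; rewrite -ltNge (lt_le_trans M1)// -invr1 lef_pV2 ?posrE.
apply: ub_le_sup.
  (* The supremum dominates only a bounded set: eigenvalues are roots of the characteristic
     polynomial, so the sum of the moduli of all roots is an upper bound. *)
  have [rs rsE] := closed_field_poly_normal (char_poly (map_mx (real_complex R) M)).
  exists (\sum_(z <- rs) ComplexField.Normc.normc z) => _ [z/= + <-].
  rewrite eigenvalue_root_char rsE (monicP (char_poly_monic _)) scale1r root_prod_XsubC.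
  move=> zrs; rewrite (big_rem z)//= lerDl sumr_ge0// => w _.
  by case: w => a b /=; exact: sqrtr_ge0.
exists (real_complex R t^-1) => /=; last first.
  rewrite /= expr0n/= addr0 sqrtr_sqr ger0_norm// invr_ge0.
  exact: ltW.
by rewrite eigenvalue_map.
Qed.

(** Put the vectorized [L] in the first block of [c] and solve [x = companion A B *m x + c] through
    the resolvent. The identity blocks make all blocks of [x] equal, so the first block row becomes
    an equation for a single matrix [X]. *)
Lemma companion_fixpoint (R : realType) (m n p : nat) (A : 'I_p -> 'M[R]_m)
    (B : 'I_p -> 'M[R]_n) (L : 'M[R]_(m, n)) :
  (0 < p)%N ->
  (forall l i k, 0 <= A l i k) -> (forall l j k, 0 <= B l j k) ->
  (forall i j, 0 <= L i j) -> spectral_radius (companion A B) < 1 ->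
  exists2 X : 'M[R]_(m, n), (forall i j, 0 <= X i j) &
    forall i j, X i j = \sum_l \sum_k \sum_r B l j k * (A l i r * X r k) + L i j.
Proof.
move=> p0 A0 B0 L0 rho.
have C0 i j : 0 <= companion A B i j.
  rewrite /companion !mxE /companion_block; case: ifP => _.
    by rewrite mxE mulr_ge0.
  by case: ifP => _; rewrite mxE ?ler0n.
(* The pair index is (column, row): stacking by columns makes [B j *t A j] act as multiplication by
   [A j] on the left and by the transpose of [B j] on the right. *)
pose vecL : 'cV[R]_(n * m) :=
  \col_k L (mxtens_unindex k).2 (mxtens_unindex k).1.
pose c : 'cV[R]_(\sum_(i < p) n * m) :=
  \mxcol_i (if i == 0%N :> nat then vecL else 0).
have c0 i : 0 <= c i 0.
  by rewrite /c mxE; case: ifP => _; rewrite mxE.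
have Cu := spectral_radius_lt1_unitmx rho.
have := resolvent_nneg C0 Cu c0; set x := _ *m c => x0.
have xE : x = companion A B *m x + c.
  have := Cu 1; rewrite scale1r ler01 lexx => /(_ isT) u1.
  have : (1%:M - companion A B) *m x = c by rewrite /x mulKVmx.
  by rewrite mulmxBl mul1mx => /eqP; rewrite subr_eq addrC => /eqP.
pose xs := submxcol x.
have xsE i : xs i = \sum_j companion_block A B i j *m xs j +
    (if i == 0%N :> nat then vecL else 0).
  rewrite {1}/xs {1}xE submxcolD /c mxcolK; congr (_ + _).
  by rewrite -{1}(submxcolK x) /companion mul_mxblock_mxrow mxcolK.
pose i0 := Ordinal p0.
have xs_const i : xs i = xs i0.
  case: i => i; elim: i => [|i IH] ip; first by congr xs; exact: val_inj.
  rewrite xsE /= addr0 -(IH (ltnW ip)) (bigD1 (Ordinal (ltnW ip)))//= big1 ?addr0.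
    by rewrite /companion_block/= eqxx mul1mx.
  move=> j ji; rewrite /companion_block/= eqSS; case: eqP => [ij|]; last by rewrite mul0mx.
  by case/eqP: ji; apply: val_inj.
have xs0 i k : 0 <= xs i k 0 by rewrite /xs mxE.
clearbody xs.
exists (\matrix_(r, s) xs i0 (mxtens_index (s, r)) 0) => [i j|i j].
  by rewrite mxE.
rewrite mxE {1}xsE [LHS]mxE summxE/= [vecL _ _]mxE mxtens_indexK/=; congr (_ + _).
apply: eq_bigr => l _; rewrite xs_const /companion_block/= mxE.
rewrite pair_big/= (reindex (@mxtens_index n m))/=; last first.
  by exists (@mxtens_unindex n m) => ? _; rewrite ?mxtens_indexK ?mxtens_unindexK.
by apply: eq_bigr => -[k r] _; rewrite tensmxE !mxE mulrA.
Qed.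

(** * Countably valued measurable functions *)

Section SigmaAlgebra.
Context {X : Type} {S : set (set X)}.
Hypothesis sS : sigma_algebra setT S.

Lemma sigma_algebraC (A : set X) : S A -> S (~` A).
Proof. by case: sS => _ sD _ /sD; rewrite setTD. Qed.

Lemma sigma_algebra_bigcup (I : countType) (F : I -> set X) :
  (forall i, S (F i)) -> S (\bigcup_i F i).
Proof.
move=> SF; case: sS => s0 _ sU.
rewrite (_ : \bigcup_i F i = \bigcup_k oapp F set0 (unpickle k)).
  by apply: sU => k; case: unpickle => //=.
apply/seteqP; split=> [x [i _ Fix]|x [k _]].
  by exists (pickle i) => //; rewrite pickleK.
by case: unpickle => //= i Fix; exists i.
Qed.

Lemma sigma_algebra_bigcap (I : countType) (F : I -> set X) :
  (forall i, S (F i)) -> S (\bigcap_i F i).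
Proof.
move=> SF; rewrite -[X in S X]setCK setC_bigcap.
by apply: sigma_algebraC; apply: sigma_algebra_bigcup => i; exact: sigma_algebraC.
Qed.

Lemma sigma_algebraI (A B : set X) : S A -> S B -> S (A `&` B).
Proof.
move=> SA SB.
rewrite (_ : A `&` B = \bigcap_(b : bool) (if b then A else B)).
  by apply: sigma_algebra_bigcap => -[].
apply/seteqP; split=> [x [Ax Bx] [] //|x xAB].
by split; [exact: (xAB true)|exact: (xAB false)].
Qed.

Lemma sigma_algebra_bigcap_seq (I : eqType) (s : seq I) (F : I -> set X) :
  {in s, forall i, S (F i)} -> S (\bigcap_(i in [set` s]) F i).
Proof.
elim: s => [_|i s IH SF].
  rewrite classical_sets.set_nil bigcap_set0 -setC0; apply: sigma_algebraC.
  by case: sS.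
rewrite (_ : [set` i :: s] = i |` [set` s]) ?bigcap_setU1; last first.
  by rewrite predeqE => k /=; rewrite inE; apply: iff_sym; split=> /predU1P.
apply: sigma_algebraI.
  by apply: SF; rewrite mem_head.
by apply: IH => k sk; apply: SF; rewrite inE sk orbT.
Qed.

(** Measurability for the full power set on [T]. The system [S] is a parameter because the same
    closure rules serve the ambient sigma-algebra and those generated by some of the drivers. *)
Definition discrete_mfun (T : Type) (f : X -> T) : Prop :=
  forall C : set T, S (f @^-1` C).

Lemma discrete_mfun_cst (T : Type) (a : T) : discrete_mfun (fun=> a).
Proof.
move=> C; rewrite preimage_cst; case: sS => s0 _ _; case: ifP => _ //.
by rewrite -setC0; exact: sigma_algebraC.
Qed.

Lemma discrete_mfun_comp (T U : Type) (f : X -> T) (g : T -> U) :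
  discrete_mfun f -> discrete_mfun (g \o f).
Proof. by move=> mf C; rewrite comp_preimage; exact: mf. Qed.

(** Split the preimage along the countably many values of [f]. This handles thinnings, whose number
    of terms is random. *)
Lemma discrete_mfun_bind (T : countType) (U : Type) (f : X -> T) (g : T -> X -> U) :
  discrete_mfun f -> (forall a, discrete_mfun (g a)) ->
  discrete_mfun (fun x => g (f x) x).
Proof.
move=> mf mg C; rewrite (_ : _ @^-1` _ = \bigcup_a (f @^-1` [set a] `&` g a @^-1` C)).
  by apply: sigma_algebra_bigcup => a; apply: sigma_algebraI; [exact: mf|exact: mg].
by apply/seteqP; split=> [x Cx|x [a _ [<-]]]; first by exists (f x).
Qed.

Lemma discrete_mfun2 (T U : countType) (V : Type) (f : X -> T) (g : X -> U) (h : T -> U -> V) :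
  discrete_mfun f -> discrete_mfun g -> discrete_mfun (fun x => h (f x) (g x)).
Proof.
move=> mf mg; apply: (@discrete_mfun_bind _ _ f (fun a x => h a (g x))) => // a.
exact: (discrete_mfun_comp (h a) mg).
Qed.

Lemma discrete_mfun_big (T : countType) (op : T -> T -> T) (idx : T) (I : Type)
    (r : seq I) (f : I -> X -> T) :
  (forall i, discrete_mfun (f i)) ->
  discrete_mfun (fun x => \big[op/idx]_(i <- r) f i x).
Proof.
move=> mf; elim: r => [|i r IH].
  by under eq_fun do rewrite big_nil; exact: discrete_mfun_cst.
under eq_fun do rewrite big_cons.
exact: (discrete_mfun2 op (mf i) IH).
Qed.

Lemma discrete_mfun_singleton (T : countType) (f : X -> T) :
  (forall a, S (f @^-1` [set a])) -> discrete_mfun f.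
Proof.
(* The preimage under the constant function is everything or empty, so the union keeps exactly the
   fibres over points of [C]. *)
move=> mf C; rewrite (_ : _ @^-1` _ =
    \bigcup_a (f @^-1` [set a] `&` (fun=> a) @^-1` C)).
  apply: sigma_algebra_bigcup => a; apply: sigma_algebraI => //.
  exact: discrete_mfun_cst.
by apply/seteqP; split=> [x Cx|x [a _ [<-]]]; first by exists (f x).
Qed.

(** Finite functions form a countable target, so it suffices to check the fibres, which are finite
    intersections. *)
Lemma discrete_mfun_ffun (I : finType) (T : countType) (f : I -> X -> T) :
  (forall i, discrete_mfun (f i)) -> discrete_mfun (fun x => [ffun i => f i x]).
Proof.
move=> mf; apply: discrete_mfun_singleton => g.
rewrite (_ : _ @^-1` _ = \bigcap_i (f i @^-1` [set g i])).
  by apply: sigma_algebra_bigcap => i; exact: mf.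
apply/seteqP; split=> [x /= <- i _|x fx]; first by rewrite /= ffunE.
by apply/ffunP => i; rewrite ffunE; exact: fx.
Qed.

Lemma discrete_mfun_matrix (m n : nat) (T : countType) (f : 'I_m -> 'I_n -> X -> T) :
  (forall i j, discrete_mfun (f i j)) ->
  discrete_mfun (fun x => \matrix_(i, j) f i j x).
Proof.
move=> mf.
have := @discrete_mfun_ffun ('I_m * 'I_n)%type T (fun ij => f ij.1 ij.2) (fun ij => mf _ _).
move=> /(discrete_mfun_comp (fun g : {ffun 'I_m * 'I_n -> T} => \matrix_(i, j) g (i, j))).
congr discrete_mfun; apply/funext => x /=.
by apply/matrixP => i j; rewrite !mxE ffunE.
Qed.

End SigmaAlgebra.
Arguments discrete_mfun {X} S {T} f.

(** * Eventually constant sequences *)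

Definition eventually_eq (T : Type) (u : nat -> T) (a : T) : Prop :=
  \forall k \near \oo, u k = a.

(** The value [a0] is taken when the sequence never stabilizes, so limits of random sequences are
    defined everywhere and not only almost everywhere. *)
Definition stable_limit (T : choiceType) (a0 : T) (u : nat -> T) : T :=
  xget a0 (eventually_eq u).

Lemma eventually_eq_inj (T : Type) (u : nat -> T) (a b : T) :
  eventually_eq u a -> eventually_eq u b -> a = b.
Proof.
move=> ua ub; have : \forall k \near \oo, a = b.
  by apply: filterS2 ua ub => k <- <-.
by move=> /filter_ex[].
Qed.

Lemma stable_limitP (T : choiceType) (a0 a : T) (u : nat -> T) :
  eventually_eq u a -> stable_limit a0 u = a.
Proof.
move=> ua; apply: (eventually_eq_inj _ ua).
by apply: (@xgetPex _ a0); exists a.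
Qed.

Lemma discrete_mfun_stable_limit (X : Type) (S : set (set X)) (T : countType)
    (a0 : T) (f : nat -> X -> T) :
  sigma_algebra setT S -> (forall k, discrete_mfun S (f k)) ->
  discrete_mfun S (fun x => stable_limit a0 (f ^~ x)).
Proof.
move=> sS mf.
pose E a := [set x | eventually_eq (f ^~ x) a].
have SE a : S (E a).
  rewrite (_ : E a = \bigcup_N \bigcap_k (if (N <= k)%N then f k @^-1` [set a] else setT)).
    apply: (sigma_algebra_bigcup sS) => N; apply: (sigma_algebra_bigcap sS) => k.
    by case: ifP => _; [exact: mf|exact: (discrete_mfun_cst sS tt setT)].
  apply/seteqP; split=> [x [N _ fN]|x [N _ fN]].
    by exists N => // k _; case: ifP => // /fN.
  by exists N => // k /= Nk; have := fN k I; rewrite Nk.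
apply: (discrete_mfun_singleton sS) => a.
(* [D] contributes the points without a limit, where the default value is taken; it is empty unless
   [a] is that default. *)
pose D := ~` (\bigcup_b E b) `&` (fun=> a0) @^-1` [set a].
rewrite (_ : _ @^-1` _ = ~` (~` E a `&` ~` D)).
  apply: (sigma_algebraC sS); apply: (sigma_algebraI sS).
    exact: (sigma_algebraC sS).
  apply: (sigma_algebraC sS); apply: (sigma_algebraI sS).
    by apply: (sigma_algebraC sS); exact: (sigma_algebra_bigcup sS).
  exact: (discrete_mfun_cst sS).
apply/seteqP; split=> [x /= xa [nE nD]|x].
  have [[b ub]|nu] := pselect (exists b, E b x).
    by apply: nE; rewrite -xa (stable_limitP a0 ub).
  apply: nD; split; first by move=> -[b _ ub]; apply: nu; exists b.
  by rewrite -xa /= /stable_limit xgetPN// => b ub; apply: nu; exists b.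
rewrite -setCU setCK => -[/(stable_limitP a0)//|[nE a0a]].
by rewrite -a0a /= /stable_limit xgetPN// => b ub; apply: nE; exists b.
Qed.

Lemma stable_limit_bounded (u : nat -> nat) (K : nat) :
  (forall k, (u k <= u k.+1)%N) -> (forall k, (u k <= K)%N) ->
  exists a, eventually_eq u a.
Proof.
move=> u_incr uK.
have exu : exists a, `[< exists k, u k = a >] by exists (u 0%N); apply/asboolP; exists 0%N.
have ub a : `[< exists k, u k = a >] -> (a <= K)%N by move=> /asboolP[k <-].
(* The range has a largest element, attained at some rank; monotonicity keeps the sequence there
   afterwards. *)
case: (ex_maxnP exu ub) => a /asboolP[N uN] amax.
exists a, N => // k /= Nk; apply/eqP; rewrite eqn_leq amax/=; last by apply/asboolP; exists k.
rewrite -uN; elim: k Nk => [|k IH]; first by rewrite leqn0 => /eqP->.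
by rewrite leq_eqVlt => /predU1P[->//|/IH h]; exact: leq_trans h (u_incr k).
Qed.

(** * Independence *)

Section Independence.
Context {R : realType} {d : measure_display} {Omega : measurableType d}.
Variable P : probability Omega R.

Lemma independent2_sym (F G : set (set Omega)) :
  independent2 P F G -> independent2 P G F.
Proof. by move=> FG C D GC FD; rewrite setIC muleC; exact: FG. Qed.

Lemma independent2_sub (F F' G G' : set (set Omega)) :
  F' `<=` F -> G' `<=` G -> independent2 P F G -> independent2 P F' G'.
Proof. by move=> F'F G'G FG C D /F'F ? /G'G ?; exact: FG. Qed.

(** Dynkin's pi-lambda argument: for fixed [D], the events that satisfy the product rule with [D]
    form a Dynkin class containing the pi-system [F]. *)
Lemma independent2_g_sigma (F G : set (set Omega)) :
  setI_closed F -> F `<=` measurable -> G `<=` measurable ->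
  independent2 P F G -> independent2 P <<s F >> G.
Proof.
move=> FI mF mG FG C D + GD; move: C.
have mD := mG _ GD.
suff : <<s F >> `<=` [set C | measurable C /\ P (C `&` D) = (P C * P D)%E].
  by move=> h C /h[].
rewrite -setI_closed_g_dynkin_g_sigma_algebra//; apply: smallest_sub; last first.
  by move=> C FC; split; [exact: mF|exact: FG].
split.
- by split; [exact: measurableT|rewrite setTI probability_setT mul1e].
- move=> C [mC PC]; split; first exact: measurableC.
  rewrite probability_setC// muleBl ?fin_num_measure// mul1e -PC.
  rewrite setIC -setDE (setIC C); apply: measureD => //.
  by rewrite -ge0_fin_numE ?fin_num_measure.
- move=> C tC CP.
  have [mC PC] : (forall k, measurable (C k)) /\
      (forall k, P (C k `&` D) = (P (C k) * P D)%E).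
    by split=> k; case: (CP k).
  split; first exact: bigcup_measurable.
  rewrite setI_bigcupl !measure_semi_bigcup//.
  + rewrite muleC -(fineK (fin_num_measure P D mD)) -nneseriesZl//.
    apply: eq_eseriesr => k _; rewrite fineK ?fin_num_measure// muleC; exact: PC.
  + exact: bigcup_measurable.
  + by move=> k; apply: measurableI.
  + exact: trivIset_setIr.
  + by apply: bigcup_measurable => k _; apply: measurableI.
Qed.

Lemma independent2_g_sigma2 (F G : set (set Omega)) :
  setI_closed F -> setI_closed G -> F `<=` measurable -> G `<=` measurable ->
  independent2 P F G -> independent2 P <<s F >> <<s G >>.
Proof.
move=> FI GI mF mG FG; apply: independent2_g_sigma => //.
  by apply: smallest_sub => //; exact: sigma_algebra_measurable.
by apply/independent2_sym/independent2_g_sigma => //; exact/independent2_sym.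
Qed.

(** A union of sigma-algebras is in general not closed under intersection; these finite
    intersections supply the pi-system for Dynkin's argument. *)
Definition cylinders (X : Type) (I : eqType) (F : I -> set (set X)) (J : set I) : set (set X) :=
  [set A | exists (s : seq I) (C : I -> set X),
    [/\ uniq s, {in s, forall i, J i}, {in s, forall i, F i (C i)} &
        A = \bigcap_(i in [set` s]) C i]].

Lemma cylinders_setI (X : Type) (I : eqType) (F : I -> set (set X)) (J : set I) :
  (forall i, setI_closed (F i)) -> (forall i, F i setT) -> setI_closed (cylinders F J).
Proof.
move=> FI FT _ _ [s1 [C1 [_ Js1 FC1 ->]]] [s2 [C2 [_ Js2 FC2 ->]]].
(* Indices missing from one of the lists get the full set there; [undup] counts common indices
   once. *)
exists (undup (s1 ++ s2)), (fun i => (if i \in s1 then C1 i else setT) `&`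
  (if i \in s2 then C2 i else setT)); split.
- exact: undup_uniq.
- by move=> i; rewrite mem_undup mem_cat => /orP[/Js1|/Js2].
- by move=> i _; apply: FI; [case: ifP => // /FC1|case: ifP => // /FC2].
- apply/seteqP; split=> [w [w1 w2] i _|w h].
    by split; case: ifP => // ?; [exact: w1|exact: w2].
  by split=> i /= si; have := h i; rewrite /= mem_undup mem_cat si ?orbT => /(_ isT)[].
Qed.

Lemma cylinders_sub (X : Type) (I : eqType) (F : I -> set (set X)) (J : set I) :
  \bigcup_(i in J) F i `<=` cylinders F J.
Proof.
move=> A [i Ji FA]; exists [:: i], (fun=> A); split=> //.
- by move=> k; rewrite inE => /eqP->.
- by move=> k; rewrite inE => /eqP->.
- apply/seteqP; split=> [w Aw k //|w]; apply.
  by rewrite /= inE.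
Qed.

(** Two cylinders over disjoint index sets intersect in a cylinder over the concatenated list, where
    the product formula splits. Dynkin's argument on both sides then extends this to the generated
    sigma-algebras. *)
Lemma mutually_independent_groups (I : eqType) (F : I -> set (set Omega)) (J K : set I) :
  (forall i, setI_closed (F i)) -> (forall i, F i setT) ->
  (forall i, F i `<=` measurable) -> J `&` K = set0 -> mutually_independent P F ->
  independent2 P <<s \bigcup_(i in J) F i >> <<s \bigcup_(i in K) F i >>.
Proof.
move=> FI FT mF JK indF.
have mcyl L : cylinders F L `<=` measurable.
  move=> _ [s [C [_ _ FC ->]]].
  apply: (sigma_algebra_bigcap_seq (sigma_algebra_measurable _)) => i si.
  by apply: (mF i); exact: FC.
apply: (@independent2_sub <<s cylinders F J >> _ <<s cylinders F K >>).
- by apply: sub_sigma_algebra2; exact: cylinders_sub.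
- by apply: sub_sigma_algebra2; exact: cylinders_sub.
apply: independent2_g_sigma2; rewrite ?mcyl//; try exact: cylinders_setI.
move=> _ _ [s1 [C1 [us1 Js1 FC1 ->]]] [s2 [C2 [us2 Js2 FC2 ->]]].
have s12 i : i \in s1 -> i \in s2 -> False.
  by move=> /Js1 Ji /Js2 Ki; suff : set0 i by []; rewrite -JK.
pose C i := if i \in s1 then C1 i else C2 i.
have C1E : \bigcap_(i in [set` s1]) C1 i = \bigcap_(i in [set` s1]) C i.
  by apply: eq_bigcapr => i /= si; rewrite /C si.
have CE2 i : i \in s2 -> C i = C2 i.
  by move=> si2; rewrite /C; case: ifP => // si1; case: (s12 i).
have C2E : \bigcap_(i in [set` s2]) C2 i = \bigcap_(i in [set` s2]) C i.
  by apply: eq_bigcapr => i /= /CE2.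
have FC i : i \in s1 ++ s2 -> F i (C i).
  rewrite mem_cat => /orP[si|si]; first by rewrite /C si; exact: FC1.
  by rewrite CE2//; exact: FC2.
have us : uniq (s1 ++ s2).
  rewrite cat_uniq us1 us2 andbT/=; apply/hasPn => i si2.
  by apply/negP => /s12; exact.
rewrite C1E C2E -bigcap_setU (_ : _ `|` _ = [set` s1 ++ s2]); last first.
  by apply/seteqP; split=> i /=; rewrite mem_cat => /orP.
rewrite !indF ?big_cat//= => i si; apply: FC; rewrite mem_cat si ?orbT//.
Qed.

(** Independence survives reindexing along an injection; the left inverse [g] extends a family of
    events from [J] to [I]. The time shift of the drivers is such a reindexing. *)
Lemma mutually_independent_can (I J : eqType) (F : I -> set (set Omega)) (f : J -> I) (g : I -> J) :
  cancel f g -> mutually_independent P F -> mutually_independent P (F \o f).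
Proof.
move=> fK indF s C us FC.
have := indF (map f s) (C \o g); rewrite map_inj_uniq ?big_map; last exact: can_inj fK.
move=> /(_ us) /= h.
rewrite (_ : \bigcap_(i in [set` s]) C i = \bigcap_(i in [set` map f s]) C (g i)).
  rewrite h; first by apply: eq_bigr => j _; rewrite fK.
  by move=> _ /mapP[j sj ->]; rewrite fK; exact: FC.
apply/seteqP; split=> w Cw.
  by move=> _ /= /mapP[j sj ->]; rewrite fK; exact: Cw.
by move=> j /= sj; rewrite -(fK j); apply: Cw => /=; exact: map_f.
Qed.

End Independence.

(** * Laws of random paths with independent coordinates *)

Definition coordinate_sigma (I T : Type) (J : set I) : set (set (I -> T)) :=
  <<s \bigcup_(i in J) [set @^~ i @^-1` C | C in [set: set T]] >>.

Lemma sigma_algebra_preimages (X T : Type) (f : X -> T) :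
  sigma_algebra setT [set f @^-1` C | C in [set: set T]].
Proof.
split=> [|_ [C _ <-]|A AC]; first by exists set0.
  by exists (~` C) => //; rewrite setTD.
have /choice[C CA] : forall k, exists C, f @^-1` C = A k.
  by move=> k; have [C _ <-] := AC k; exists C.
by exists (\bigcup_k C k) => //; rewrite preimage_bigcup; apply: eq_bigcupr => k _; exact: CA.
Qed.

Lemma coordinate_sigma_preimage (Omega I T : Type) (S : set (set Omega)) (J : set I)
    (X : Omega -> I -> T) :
  sigma_algebra setT S -> (forall i C, J i -> S (X ^~ i @^-1` C)) ->
  forall A, coordinate_sigma J A -> S (X @^-1` A).
Proof.
move=> sS SX; apply: smallest_sub; last by move=> _ [i Ji [C _ <-]]; exact: SX.
split=> [|A SA|A SA].
- by rewrite /= preimage_set0; case: sS.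
- by rewrite /= setTD preimage_setC; exact: sigma_algebraC.
- by rewrite /= preimage_bigcup; case: sS => _ _; exact.
Qed.

(* Both laws agree on finite-dimensional cylinders, which form a pi-system. *)
Lemma eq_path_law (R : realType) (d : measure_display) (Omega : measurableType d)
    (P : probability Omega R) (I : eqType) (T : Type) (X X' : Omega -> I -> T) :
  let F (Y : Omega -> I -> T) i := [set Y ^~ i @^-1` C | C in [set: set T]] in
  (forall i C, measurable (X ^~ i @^-1` C)) ->
  (forall i C, measurable (X' ^~ i @^-1` C)) ->
  (forall i C, P (X ^~ i @^-1` C) = P (X' ^~ i @^-1` C)) ->
  mutually_independent P (F X) -> mutually_independent P (F X') ->
  forall A, coordinate_sigma setT A -> P (X @^-1` A) = P (X' @^-1` A).
Proof.
move=> F mX mX' XX' indX indX'.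
pose G i := [set (fun x : I -> T => x i) @^-1` C | C in [set: set T]].
have GI i : setI_closed (G i).
  by move=> A B; apply: sigma_algebraI; exact: sigma_algebra_preimages.
have GT i : G i setT by exists setT.
(* Measurability of both preimages is built into the class, since the complement and union steps
   rely on it. *)
suff : <<s cylinders G setT >> `<=` [set A | [/\ measurable (X @^-1` A),
    measurable (X' @^-1` A) & P (X @^-1` A) = P (X' @^-1` A)]].
  move=> h A sA; have [] // := h A; move: A sA {h}.
  by apply: sub_sigma_algebra2; exact: cylinders_sub.
rewrite -setI_closed_g_dynkin_g_sigma_algebra; last exact: cylinders_setI.
apply: smallest_sub; last first.
  move=> _ [s [C [us _ GC ->]]].
  have /choice[D DC] : forall i, exists D, i \in s -> (fun x : I -> T => x i) @^-1` D = C i.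
    move=> i; have [si|nsi] := boolP (i \in s); last by exists set0.
    by have [D _ DC] := GC i si; exists D.
  have XE (Y : Omega -> I -> T) : Y @^-1` (\bigcap_(i in [set` s]) C i) =
      \bigcap_(i in [set` s]) (Y ^~ i @^-1` D i).
    by rewrite preimage_bigcap; apply: eq_bigcapr => i /= si; rewrite -DC.
  have mXE (Y : Omega -> I -> T) : (forall i C, measurable (Y ^~ i @^-1` C)) ->
      measurable (\bigcap_(i in [set` s]) (Y ^~ i @^-1` D i)).
    by move=> mY; apply: (sigma_algebra_bigcap_seq (sigma_algebra_measurable _)) => i _.
  rewrite /= !XE; split; [exact: mXE|exact: mXE|].
  rewrite indX// ?indX'//; first by apply: eq_bigr => i _; exact: XX'.
  - by move=> i _; exists (D i).
  - by move=> i _; exists (D i).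
split=> [|A [mA mA' AA']|A tA AP].
- by rewrite /= !preimage_setT.
- split; [exact: (measurableC mA)|exact: (measurableC mA')|].
  by rewrite [LHS](probability_setC P mA) [RHS](probability_setC P mA') AA'.
- have mA k : measurable (X @^-1` A k) by case: (AP k).
  have mA' k : measurable (X' @^-1` A k) by case: (AP k).
  have mU (Y : Omega -> I -> T) : (forall k, measurable (Y @^-1` A k)) ->
      P (Y @^-1` (\bigcup_k A k)) = (\sum_(k <oo) P (Y @^-1` A k))%E /\
      measurable (Y @^-1` (\bigcup_k A k)).
    move=> mY; rewrite preimage_bigcup; split; last exact: bigcup_measurable.
    apply: measure_semi_bigcup => //; last exact: bigcup_measurable.
    by move=> i j _ _ [w [Ai Aj]]; apply: (tA i j) => //; exists (Y w).
  have [[PX mX1] [PX' mX1']] := (mU _ mA, mU _ mA').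
  split=> //; rewrite PX PX'.
  by apply: eq_eseriesr => k _; case: (AP k).
Qed.

(** * The recursion driven by a fixed realization *)

Lemma thinning_le (b : nat -> bool) (y z : nat) : (y <= z)%N -> (thinning b y <= thinning b z)%N.
Proof.
move=> yz; rewrite /thinning -(subnKC yz) big_split_ord/=; exact: leq_addr.
Qed.

Lemma left_thinning_le (m n : nat) (b : 'I_m -> 'I_n -> 'I_m -> nat -> bool)
    (Y Z : 'M[nat]_(m, n)) :
  (forall i j, (Y i j <= Z i j)%N) ->
  forall i j, (left_thinning b Y i j <= left_thinning b Z i j)%N.
Proof. by move=> YZ i j; rewrite !mxE; apply: leq_sum => k _; exact: thinning_le. Qed.

Lemma right_thinning_le (m n : nat) (b : 'I_m -> 'I_n -> 'I_n -> nat -> bool)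
    (Y Z : 'M[nat]_(m, n)) :
  (forall i j, (Y i j <= Z i j)%N) ->
  forall i j, (right_thinning b Y i j <= right_thinning b Z i j)%N.
Proof. by move=> YZ i j; rewrite !mxE; apply: leq_sum => k _; exact: thinning_le. Qed.

Section DiscreteThinning.
Context {X : Type} {S : set (set X)}.
Hypothesis sS : sigma_algebra setT S.

Lemma discrete_mfun_thinning (b : nat -> X -> bool) (y : X -> nat) :
  (forall s, discrete_mfun S (b s)) -> discrete_mfun S y ->
  discrete_mfun S (fun x => thinning (b ^~ x) (y x)).
Proof.
move=> mb my; apply: (discrete_mfun_bind sS (g := fun k x => thinning (b ^~ x) k)) => // k.
apply: (@discrete_mfun_big _ _ sS nat addn 0%N _ _ (fun s : 'I_k => fun x => b s x : nat)) => s.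
exact: (discrete_mfun_comp nat_of_bool (mb s)).
Qed.

Lemma discrete_mfun_left_thinning (m n : nat)
    (b : 'I_m -> 'I_n -> 'I_m -> nat -> X -> bool) (Y : X -> 'M[nat]_(m, n)) :
  (forall i j k s, discrete_mfun S (b i j k s)) -> discrete_mfun S Y ->
  discrete_mfun S (fun x => left_thinning (fun i j k s => b i j k s x) (Y x)).
Proof.
move=> mb mY; apply: (discrete_mfun_matrix sS) => i j.
apply: (@discrete_mfun_big _ _ sS nat addn 0%N _ _
  (fun k x => thinning (fun s => b i j k s x) (Y x k j))) => k.
apply: discrete_mfun_thinning => //.
exact: (discrete_mfun_comp (fun M : 'M[nat]_(m, n) => M k j) mY).
Qed.

Lemma discrete_mfun_right_thinning (m n : nat)
    (b : 'I_m -> 'I_n -> 'I_n -> nat -> X -> bool) (Y : X -> 'M[nat]_(m, n)) :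
  (forall i j k s, discrete_mfun S (b i j k s)) -> discrete_mfun S Y ->
  discrete_mfun S (fun x => right_thinning (fun i j k s => b i j k s x) (Y x)).
Proof.
move=> mb mY; apply: (discrete_mfun_matrix sS) => i j.
apply: (@discrete_mfun_big _ _ sS nat addn 0%N _ _
  (fun k x => thinning (fun s => b i j k s x) (Y x i k))) => k.
apply: discrete_mfun_thinning => //.
exact: (discrete_mfun_comp (fun M : 'M[nat]_(m, n) => M i k) mY).
Qed.

End DiscreteThinning.

(** * Deterministic functionals of a driver path *)

Section PathSpace.
Variables m n p : nat.

(* A realization of all drivers; inl is meant for innovations and inr for
   counting variables, other values are decoded as 0 and false. *)
Definition driver_path : Type := driver_index m n p -> 'M[nat]_(m, n) + bool.

Definition path_innovation (x : driver_path) (t : int) : 'M[nat]_(m, n) :=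
  if x (t, None) is inl M then M else 0.

Definition path_count (x : driver_path) (t : int) (c : counting_index m n p) : bool :=
  if x (t, Some c) is inr b then b else false.

Definition path_left (x : driver_path) (t : int) (l : 'I_p) : 'M[nat]_(m, n) -> 'M[nat]_(m, n) :=
  left_thinning (fun i j k s => path_count x t (l, i, j, inl k, s)).

Definition path_right (x : driver_path) (t : int) (l : 'I_p) : 'M[nat]_(m, n) -> 'M[nat]_(m, n) :=
  right_thinning (fun i j k s => path_count x t (l, i, j, inr k, s)).

Definition path_step (x : driver_path) (Y : int -> 'M[nat]_(m, n)) (t : int) : 'M[nat]_(m, n) :=
  \sum_(l < p) path_right x t l (path_left x t l (Y (t - l.+1%:Z))) + path_innovation x t.

Definition path_iter (N : nat) (x : driver_path) : int -> 'M[nat]_(m, n) :=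
  iter N (path_step x) (fun=> 0).

Definition path_solution (x : driver_path) (t : int) : 'M[nat]_(m, n) :=
  stable_limit 0 (fun N => path_iter N x t).

Lemma path_step_le (x : driver_path) (Y Z : int -> 'M[nat]_(m, n)) :
  (forall t i j, (Y t i j <= Z t i j)%N) ->
  forall t i j, (path_step x Y t i j <= path_step x Z t i j)%N.
Proof.
move=> YZ t i j; rewrite /path_step !mxE !summxE leq_add2r; apply: leq_sum => l _.
by apply: right_thinning_le; apply: left_thinning_le.
Qed.

Lemma path_iter_incr (x : driver_path) (N : nat) :
  forall t i j, (path_iter N x t i j <= path_iter N.+1 x t i j)%N.
Proof.
elim: N => [|N IH] t i j; first by rewrite [path_iter 0 x t]/= mxE.
exact: path_step_le.
Qed.

(** Bounded nondecreasing integer entries stabilize, and the step at time [t] reads only finitely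
    many of them. A common rank [N] therefore turns the relation between consecutive iterates into
    the equation for the limit. *)
Lemma path_solutionE (x : driver_path) :
  (forall t i j, exists K, forall N, (path_iter N x t i j <= K)%N) ->
  forall t, path_solution x t = path_step x (path_solution x) t.
Proof.
move=> xb.
have sol t : \forall N \near \oo, path_iter N x t = path_solution x t.
  have /choice[M MP] : forall ij : 'I_m * 'I_n, exists a,
      eventually_eq (fun N => path_iter N x t ij.1 ij.2) a.
    move=> [i j]; have [K xK] := xb t i j; apply: (stable_limit_bounded (K := K)) => //.
    by move=> N; exact: path_iter_incr.
  have lim : eventually_eq (fun N => path_iter N x t) (\matrix_(i, j) M (i, j)).
    have : \forall N \near \oo, forall ij : 'I_m * 'I_n, path_iter N x t ij.1 ij.2 = M ij.
      by apply: filter_forall => ij; exact: MP.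
    apply: filterS => N h; apply/matrixP => i j; rewrite mxE.
    exact: (h (i, j)).
  by rewrite /path_solution (stable_limitP 0 lim).
move=> t.
have : \forall N \near \oo, forall l : 'I_p,
    path_iter N x (t - l.+1%:Z) = path_solution x (t - l.+1%:Z).
  by apply: filter_forall => l.
have solS : \forall N \near \oo, path_iter N.+1 x t = path_solution x t.
  have [N0 _ h] := sol t; exists N0 => // N /= N0N; apply: (h N.+1) => /=.
  exact: leqW.
move=> solL; have [N [<- solN]] := filter_ex (filterI solS solL).
by rewrite /path_step; congr (_ + _); apply: eq_bigr => l _; rewrite -solN.
Qed.

Definition path_shift (h : int) (x : driver_path) : driver_path :=
  fun i => x (i.1 + h, i.2).

(** A step refers to time only through lags and the drivers of the current time, so shifting the
    path amounts to shifting the time of evaluation. *)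
Lemma path_iter_shift (N : nat) (h : int) (x : driver_path) (t : int) :
  path_iter N (path_shift h x) t = path_iter N x (t + h).
Proof.
elim: N t => [//|N IH] t; rewrite /path_iter/= -!/(path_iter _ _) /path_step.
by congr (_ + _); apply: eq_bigr => l _; rewrite IH addrAC.
Qed.

Lemma path_solution_shift (h : int) (x : driver_path) (t : int) :
  path_solution (path_shift h x) t = path_solution x (t + h).
Proof.
by congr stable_limit; apply/funext => N; exact: path_iter_shift.
Qed.

Notation path_sigma J := (@coordinate_sigma (driver_index m n p) ('M[nat]_(m, n) + bool)%type J).

Lemma path_sigma_algebra (J : set (driver_index m n p)) : sigma_algebra setT (path_sigma J).
Proof. exact: smallest_sigma_algebra. Qed.

Lemma discrete_mfun_coordinate (T : Type) (J : set (driver_index m n p))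
    (i : driver_index m n p) (f : 'M[nat]_(m, n) + bool -> T) :
  J i -> discrete_mfun (path_sigma J) (fun x => f (x i)).
Proof.
move=> Ji C A [_]; apply.
by exists i => //; exists (f @^-1` C).
Qed.

Lemma discrete_mfun_path_count (J : set (driver_index m n p)) (t : int) c :
  J (t, Some c) -> discrete_mfun (path_sigma J) (fun x => path_count x t c).
Proof.
by move=> ?; apply: (discrete_mfun_coordinate (fun v => if v is inr b then b else false)).
Qed.

Lemma discrete_mfun_path_innovation (J : set (driver_index m n p)) (t : int) :
  J (t, None) -> discrete_mfun (path_sigma J) (fun x => path_innovation x t).
Proof.
by move=> ?; apply: (discrete_mfun_coordinate (fun v => if v is inl M then M else 0)).
Qed.

(** Induction on [N]: a step at time [t] uses drivers of time [t] and iterates at strictly earlier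
    times, so no later driver enters. Causality comes from this. *)
Lemma discrete_mfun_path_iter (J : set (driver_index m n p)) (N : nat) (t : int) :
  (forall i, i.1 <= t -> J i) -> discrete_mfun (path_sigma J) (fun x => path_iter N x t).
Proof.
have sJ := path_sigma_algebra J.
elim: N t => [|N IH] t Jt; first exact: discrete_mfun_cst.
apply: (@discrete_mfun2 _ _ sJ _ _ _ (fun x => \sum_(l < p)
    path_right x t l (path_left x t l (path_iter N x (t - l.+1%:Z))))
    (path_innovation ^~ t) +%R); last first.
  by apply: discrete_mfun_path_innovation; exact: Jt.
apply: (discrete_mfun_big sJ) => l.
apply: (@discrete_mfun_right_thinning _ _ sJ _ _
  (fun i j k s x => path_count x t (l, i, j, inr k, s))) => [i j k s|].
  by apply: discrete_mfun_path_count; exact: Jt.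
apply: (@discrete_mfun_left_thinning _ _ sJ _ _
  (fun i j k s x => path_count x t (l, i, j, inl k, s))) => [i j k s|].
  by apply: discrete_mfun_path_count; exact: Jt.
apply: IH => i it; apply: Jt; apply: le_trans it _.
by rewrite lerBlDr lerDl.
Qed.

Lemma discrete_mfun_path_solution (J : set (driver_index m n p)) (t : int) :
  (forall i, i.1 <= t -> J i) -> discrete_mfun (path_sigma J) (fun x => path_solution x t).
Proof.
move=> Jt; apply: discrete_mfun_stable_limit; first exact: path_sigma_algebra.
by move=> N; exact: discrete_mfun_path_iter.
Qed.

End PathSpace.

(** * Means *)

Section Mean.
Context {R : realType} {d : measure_display} {Omega : measurableType d}.
Variable P : probability Omega R.
Local Open Scope ereal_scope.

Definition mean (y : Omega -> nat) : \bar R := \int[P]_w (y w)%:R%:E.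

Lemma natr_measurable (y : Omega -> nat) :
  discrete_mfun measurable y -> measurable_fun setT ((fun w => (y w)%:R%:E) : Omega -> \bar R).
Proof. by move=> my _ B mB; rewrite setTI; exact: (my (fun k => B k%:R%:E)). Qed.

Lemma mean_sum (I : Type) (r : seq I) (f : I -> Omega -> nat) :
  (forall i, discrete_mfun measurable (f i)) ->
  mean (fun w => \sum_(i <- r) f i w)%N = \sum_(i <- r) mean (f i).
Proof.
move=> mf; rewrite /mean -ge0_integral_sum//; try by move=> i; exact: natr_measurable.
by apply: eq_integral => w _; rewrite natr_sum sumEFin.
Qed.

Lemma meanD (f g : Omega -> nat) :
  discrete_mfun measurable f -> discrete_mfun measurable g ->
  mean (fun w => f w + g w)%N = mean f + mean g.
Proof.
move=> mf mg; rewrite /mean -ge0_integralD//; try exact: natr_measurable.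
by apply: eq_integral => w _; rewrite natrD.
Qed.

(** The thinning is the series of the indicators of [b s] and [s < y], whose terms beyond [y]
    vanish; nonnegativity allows integration term by term. *)
Lemma mean_thinning_series (b : nat -> Omega -> bool) (y : Omega -> nat) :
  (forall s, discrete_mfun measurable (b s)) -> discrete_mfun measurable y ->
  mean (fun w => thinning (b ^~ w) (y w)) =
  \sum_(s <oo) P ([set w | b s w] `&` [set w | (s < y w)%N]).
Proof.
move=> mb my; pose A s := [set w | b s w] `&` [set w | (s < y w)%N].
have mA s : measurable (A s).
  by apply: measurableI; [exact: (mb s id)|exact: (my (fun k => (s < k)%N))].
transitivity (\int[P]_w \sum_(s <oo) (\1_(A s) w)%:E).
  apply: eq_integral => w _; rewrite (nneseries_split _ (y w)); last first.
    by move=> s _; rewrite lee_fin.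
  rewrite [X in _ + X]eseries0 ?adde0; last first.
    move=> s /=; rewrite add0n => ys _; rewrite indicE memNset//= => -[_ /=].
    by rewrite ltnNge ys.
  rewrite add0n big_mkord /thinning natr_sum -sumEFin.
  apply: eq_bigr => s _; rewrite indicE; congr ((nat_of_bool _)%:R%:E).
  apply/idP/idP => [bw|/set_mem[]//].
  by rewrite mem_set//; split=> //=; exact: ltn_ord.
rewrite integral_nneseries//.
  by apply: eq_eseriesr => s _; rewrite integral_indic// setIT.
by move=> s; exact/measurable_EFinP/measurable_indic.
Qed.

(** A form of Wald's identity: independence factors each term of the series, and [y] itself is the
    thinning whose counting series is constantly true, so its mean has the same expansion. *)
Lemma mean_thinning (a : R) (b : nat -> Omega -> bool) (y : Omega -> nat) :
  (forall s, discrete_mfun measurable (b s)) -> discrete_mfun measurable y ->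
  (forall s, P [set w | b s w] = a%:E) ->
  (forall s, P ([set w | b s w] `&` [set w | (s < y w)%N]) =
    P [set w | b s w] * P [set w | (s < y w)%N]) ->
  mean (fun w => thinning (b ^~ w) (y w)) = a%:E * mean y.
Proof.
move=> mb my ba bind.
have -> : mean y = mean (fun w => thinning (fun=> true) (y w)).
  by congr mean; apply/funext => w; rewrite /thinning sum_nat_const card_ord muln1.
rewrite !mean_thinning_series//; last first.
  by move=> s; exact: (discrete_mfun_cst (sigma_algebra_measurable _)).
rewrite -nneseriesZl//; apply: eq_eseriesr => s _.
by rewrite bind ba (_ : [set _ | true] = setT) ?setTI//; apply/seteqP; split.
Qed.

(** Monotone convergence bounds the integral of the pointwise limit by [c], so this limit is almost
    surely finite; a natural number above it bounds the whole sequence. *)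
Lemma mean_ae_bounded (y : nat -> Omega -> nat) (c : R) :
  (forall N, discrete_mfun measurable (y N)) ->
  (forall N w, (y N w <= y N.+1 w)%N) -> (forall N, mean (y N) <= c%:E) ->
  {ae P, forall w, exists K, forall N, (y N w <= K)%N}.
Proof.
move=> my y_incr yc.
have y_mono w : {homo (fun N => (y N w)%:R%:E : \bar R) : a b / (a <= b)%N >-> a <= b}.
  move=> a b ab; rewrite lee_fin ler_nat.
  have : {homo y^~ w : a b / (a <= b)%N} by apply: homo_leq => //; exact: leq_trans.
  exact.
pose f w : \bar R := limn (fun N => (y N w)%:R%:E).
have cvf w : (fun N => (y N w)%:R%:E : \bar R) @ \oo --> f w.
  by apply: ereal_nondecreasing_is_cvgn; exact: y_mono.
have mf : measurable_fun setT f.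
  apply: (emeasurable_fun_cvg (fun N w => (y N w)%:R%:E)) => // N.
  exact: natr_measurable.
have f0 w : 0 <= f w.
  by apply: lime_ge; [exact: cvf|apply: nearW => N; rewrite lee_fin ler0n].
have fc : \int[P]_w f w <= c%:E.
  rewrite monotone_convergence//; try by move=> N; exact: natr_measurable.
  apply: lime_le; last by apply: nearW => N; exact: yc.
  apply: ereal_nondecreasing_is_cvgn => a b ab.
  apply: ge0_le_integral => //; try exact: natr_measurable.
  by move=> w _; exact: y_mono.
have If : P.-integrable setT f.
  apply/integrableP; split=> //; under eq_integral do rewrite gee0_abs//.
  by rewrite (le_lt_trans fc) ?ltry.
apply: filterS (integrable_ae measurableT If) => w /(_ I) ffin.
exists (Num.Def.archi_bound (fine (f w))) => N.
rewrite -(ler_nat R); apply: le_trans (ltW (archi_boundP _)); last by rewrite fine_ge0.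
rewrite -lee_fin fineK//; apply: lime_ge; first exact: cvf.
by exists N => // k /=; exact: y_mono.
Qed.

End Mean.

(** * Random drivers *)

Section Drivers.
Context {R : realType} {d : measure_display} {Omega : measurableType d}.
Variables (P : probability Omega R) (m n p : nat).
Variables (Lambda : 'M[R]_(m, n)) (A : 'I_p -> 'M[R]_m) (B : 'I_p -> 'M[R]_n).
Variable E : int -> {RV P >-> 'M[nat]_(m, n)}.
Variable U : int -> 'I_p -> 'I_m -> 'I_n -> 'I_m -> nat -> {RV P >-> bool}.
Variable V : int -> 'I_p -> 'I_m -> 'I_n -> 'I_n -> nat -> {RV P >-> bool}.
Hypothesis hdrivers : matinar_drivers Lambda A B E U V.

Definition driver_realization (w : Omega) : driver_path m n p := fun i =>
  match i with
  | (t, None) => inl (E t w)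
  | (t, Some (l, i, j, inl k, s)) => inr (U t l i j k s w)
  | (t, Some (l, i, j, inr k, s)) => inr (V t l i j k s w)
  end.

Local Notation X := driver_realization.
Local Notation Fs := (driver_sigma E U V).

(** The injections [inl] and [inr] lose no information and the value spaces are discrete, so a
    driver and its coded coordinate generate the same events. *)
Lemma driver_sigmaE (i : driver_index m n p) : Fs i = [set X ^~ i @^-1` C | C in setT].
Proof.
have aux (T T' : Type) (f : Omega -> T) (g : T -> T') (F : set (set T)) :
    injective g -> F = setT ->
    preimage_set_system setT f F = [set (g \o f) @^-1` C | C in setT].
  move=> g_inj ->; apply/seteqP; split=> _ [C _ <-].
    exists (g @` C) => //; rewrite setTI; apply/seteqP; split=> [w [a Ca /g_inj fa]|w Cw].
      by rewrite /preimage/= -fa.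
    by exists (f w).
  by exists (g @^-1` C) => //; rewrite setTI.
by case: i => t [[[[[l i] j] [k|k]] s]|]; apply: aux => // a b [].
Qed.

Lemma driver_sigma_measurable (i : driver_index m n p) : Fs i `<=` measurable.
Proof.
by case: i => t [[[[[l i] j] [k|k]] s]|] _ [C mC <-]; exact: measurable_funPT.
Qed.

Lemma driver_realization_measurable (i : driver_index m n p) C : measurable (X ^~ i @^-1` C).
Proof. by apply: (@driver_sigma_measurable i); rewrite driver_sigmaE; exists C. Qed.

Lemma driver_law_shift (h : int) (i : driver_index m n p) C :
  P (X ^~ (i.1 + h, i.2) @^-1` C) = P (X ^~ i @^-1` C).
Proof.
case: i => t [[[[[l i] j] [k|k]] s]|] /=.
- have UB t' := U_bernoulli hdrivers t' l i j k s (inr @^-1` C).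
  exact: (etrans (UB (t + h)) (esym (UB t))).
- have VB t' := V_bernoulli hdrivers t' l i j k s (inr @^-1` C).
  exact: (etrans (VB (t + h)) (esym (VB t))).
- have EE t' := E_identically_distributed hdrivers t' (inl @^-1` C).
  exact: (etrans (EE (t + h)) (esym (EE t))).
Qed.

Lemma path_law_shift (h : int) (S : set (driver_path m n p)) :
  coordinate_sigma setT S -> P ((path_shift h \o X) @^-1` S) = P (X @^-1` S).
Proof.
apply: eq_path_law.
- by move=> i C; exact: driver_realization_measurable.
- by move=> i C; exact: driver_realization_measurable.
- by move=> i C; exact: driver_law_shift.
(* Translating time by [h] is undone by translating by [-h], so the shifted drivers are again
   independent. *)
- have := @mutually_independent_can _ _ _ P _ (driver_index m n p) Fs (fun i => (i.1 + h, i.2))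
    (fun i => (i.1 - h, i.2)) _ (drivers_independent hdrivers).
  rewrite (_ : Fs \o _ = fun i => [set X ^~ (i.1 + h, i.2) @^-1` C | C in setT]).
    by apply=> -[t c] /=; rewrite addrK.
  by apply/funext => i; exact: driver_sigmaE.
- have := drivers_independent hdrivers.
  by congr mutually_independent; apply/funext => i; exact: driver_sigmaE.
Qed.

Lemma discrete_mfun_drivers (T : Type) (J : set (driver_index m n p)) (f : driver_path m n p -> T) :
  discrete_mfun (coordinate_sigma J) f ->
  discrete_mfun <<s \bigcup_(i in J) Fs i >> (f \o X).
Proof.
move=> mf C.
have XS i D : J i -> <<s \bigcup_(i in J) Fs i >> (X ^~ i @^-1` D).
  move=> Ji S [_]; apply; exists i => //.
  by rewrite driver_sigmaE; exists D.
exact: (coordinate_sigma_preimage (smallest_sigma_algebra _ _) XS (mf C)).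
Qed.

Lemma drivers_sub_measurable (J : set (driver_index m n p)) :
  <<s \bigcup_(i in J) Fs i >> `<=` measurable.
Proof.
apply: smallest_sub; first exact: sigma_algebra_measurable.
by move=> S [i _]; exact: driver_sigma_measurable.
Qed.

Lemma discrete_mfun_realization (T : Type) (J : set (driver_index m n p))
    (f : driver_path m n p -> T) :
  discrete_mfun (coordinate_sigma J) f -> discrete_mfun measurable (f \o X).
Proof. by move=> mf C; apply: drivers_sub_measurable; exact: discrete_mfun_drivers. Qed.

Lemma drivers_independent_groups (J K : set (driver_index m n p)) : J `&` K = set0 ->
  independent2 P <<s \bigcup_(i in J) Fs i >> <<s \bigcup_(i in K) Fs i >>.
Proof.
move=> JK; apply: mutually_independent_groups => //.
- by move=> i; rewrite driver_sigmaE => S T; apply: sigma_algebraI; exact: sigma_algebra_preimages.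
- by move=> i; rewrite driver_sigmaE; exists setT.
- exact: driver_sigma_measurable.
- exact: drivers_independent hdrivers.
Qed.

(** The argument [y] depends only on drivers in [J] and the counting variables lie outside [J], so
    independence of disjoint groups of drivers provides what the mean of a thinning requires. *)
Lemma mean_driver_thinning (J : set (driver_index m n p)) (t : int)
    (c : nat -> counting_index m n p) (a : R) (y : driver_path m n p -> nat) :
  (forall s, P [set w | path_count (X w) t (c s)] = a%:E) ->
  (forall s, ~ J (t, Some (c s))) -> discrete_mfun (coordinate_sigma J) y ->
  mean P (fun w => thinning (fun s => path_count (X w) t (c s)) (y (X w))) =
  (a%:E * mean P (fun w => y (X w)))%E.
Proof.
move=> ca nJc my; have mc s : discrete_mfun (coordinate_sigma [set (t, Some (c s))])
  (fun x => path_count x t (c s)) by exact: discrete_mfun_path_count.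
apply: (@mean_thinning _ _ _ P a (fun s w => path_count (X w) t (c s)) (y \o X)) => //.
- by move=> s; exact: (discrete_mfun_realization (mc s)).
- exact: (discrete_mfun_realization my).
- move=> s; apply: (@drivers_independent_groups [set (t, Some (c s))] J).
  + by apply/seteqP; split=> // i [-> /nJc].
  + exact: (discrete_mfun_drivers (mc s) id).
  + exact: (discrete_mfun_drivers my (fun k => (s < k)%N)).
Qed.

Lemma bernoulli_prob_true (a : R) : 0 <= a <= 1 -> bernoulli_prob a [set b | b] = a%:E.
Proof.
move=> a01; rewrite bernoulli_probE// !diracE mem_set// memNset// mule1 mule0 adde0.
by [].
Qed.

(** Each thinning multiplies a mean by its parameter, so the means of the iterates follow a monotone
    recursion of which [M] is a nonnegative fixed point; starting from 0, they stay below it. *)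
Lemma mean_path_iter (M : 'M[R]_(m, n)) :
  (forall i j, 0 <= M i j) ->
  (forall i j, M i j = \sum_l \sum_k \sum_r B l j k * (A l i r * M r k) + Lambda i j) ->
  forall N t i j, (mean P (fun w => path_iter N (X w) t i j) <= (M i j)%:E)%E.
Proof.
move=> M0 ME; elim=> [|N IH] t i j.
  rewrite /mean; under eq_integral do rewrite /path_iter/= mxE.
  by rewrite integral0 lee_fin.
pose u l k r w := thinning (fun s => path_count (X w) t (l, i, k, inl r, s))
  (path_iter N (X w) (t - l.+1%:Z) r k).
pose z l k w := (\sum_r u l k r w)%N.
pose v l k w := thinning (fun s => path_count (X w) t (l, i, j, inr k, s)) (z l k w).
have iterE w : path_iter N.+1 (X w) t i j = (\sum_l \sum_k v l k w + E t w i j)%N.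
  rewrite [path_iter _ _ _]/= /path_step mxE summxE; congr addn.
  apply: eq_bigr => l _; rewrite mxE; apply: eq_bigr => k _.
  by rewrite /v mxE.
(* Drivers before [t] determine the lagged iterates; [J2] adds the left counting series of time [t],
   which then determine the left-thinned entries. The right series of time [t] lie outside [J2]. *)
pose J1 := [set x : driver_index m n p | x.1 < t].
pose J2 := [set x : driver_index m n p | x.1 < t \/
  exists l i j k s, x = (t, Some (l, i, j, inl k, s))].
have lagE (l : 'I_p) : t - l.+1%:Z < t by rewrite ltrBlDr ltrDl.
have mY J (l : 'I_p) r k : J1 `<=` J ->
    discrete_mfun (coordinate_sigma J) (fun x => path_iter N x (t - l.+1%:Z) r k).
  move=> J1J; apply: (discrete_mfun_comp (fun M : 'M[nat]_(m, n) => M r k)).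
  apply: discrete_mfun_path_iter => x xt; apply: J1J.
  exact: le_lt_trans xt (lagE l).
pose pz l k (x : driver_path m n p) :=
  (\sum_r thinning (fun s => path_count x t (l, i, k, inl r, s))
    (path_iter N x (t - l.+1%:Z) r k))%N.
have mu J l k r : J2 `<=` J -> discrete_mfun (coordinate_sigma J)
    (fun x => thinning (fun s => path_count x t (l, i, k, inl r, s))
    (path_iter N x (t - l.+1%:Z) r k)).
  move=> J2J; apply: (@discrete_mfun_thinning _ _ (path_sigma_algebra J)
    (fun s x => path_count x t (l, i, k, inl r, s))).
    move=> s; apply: discrete_mfun_path_count; apply: J2J; right.
    by exists l, i, k, r, s.
  by apply: mY => x xt; apply: J2J; left.
have mz J l k : J2 `<=` J -> discrete_mfun (coordinate_sigma J) (pz l k).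
  move=> J2J; apply: (@discrete_mfun_big _ _ (path_sigma_algebra J) nat addn 0%N) => r.
  exact: mu.
have mv l k : discrete_mfun (coordinate_sigma setT)
    (fun x => thinning (fun s => path_count x t (l, i, j, inr k, s)) (pz l k x)).
  apply: (@discrete_mfun_thinning _ _ (path_sigma_algebra setT)
    (fun s x => path_count x t (l, i, j, inr k, s))); last exact: mz.
  by move=> s; exact: discrete_mfun_path_count.
have mean_v l k : mean P (v l k) = ((B l j k)%:E * mean P (z l k))%E.
  apply: (@mean_driver_thinning J2 t (fun s => (l, i, j, inr k, s)) _ (pz l k)).
  - move=> s; rewrite -(bernoulli_prob_true (B_itv hdrivers l j k)).
    have := V_bernoulli hdrivers t l i j k s [set b | b]; rewrite mxE; exact.
  - by move=> s [|[? [? [? [? [? []]]]]]]; rewrite //= ltxx.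
  - exact: mz.
have mean_u l k r : (mean P (u l k r) <= (A l i r * M r k)%:E)%E.
  rewrite (@mean_driver_thinning J1 t (fun s => (l, i, k, inl r, s)) (A l i r)
    (fun x => path_iter N x (t - l.+1%:Z) r k)).
  - by rewrite EFinM lee_wpmul2l// lee_fin; have /andP[] := A_itv hdrivers l i r.
  - move=> s; rewrite -(bernoulli_prob_true (A_itv hdrivers l i r)).
    by have := U_bernoulli hdrivers t l i k r s [set b | b]; exact.
  - by move=> s; rewrite /J1/= ltxx.
  - exact: mY.
have mean_E : mean P (fun w => E t w i j) = (Lambda i j)%:E.
  by have := E_mean hdrivers t i j; rewrite unlock.
have mvX l k : discrete_mfun measurable (v l k) by exact: (discrete_mfun_realization (mv l k)).
have mzX l k r : discrete_mfun measurable (u l k r).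
  exact: (discrete_mfun_realization (mu setT l k r _)).
have sM := sigma_algebra_measurable Omega.
rewrite (_ : (fun w => _) = fun w => (\sum_l \sum_k v l k w + E t w i j)%N); last exact/funext.
rewrite meanD; last 2 first.
- apply: (@discrete_mfun_big _ _ sM nat addn 0%N) => l.
  exact: (@discrete_mfun_big _ _ sM nat addn 0%N).
- move=> C; apply: (@driver_sigma_measurable (t, None)).
  by exists [set M : 'M[nat]_(m, n) | C (M i j)] => //; rewrite setTI.
rewrite mean_E ME EFinD leeD2r// mean_sum; last first.
  by move=> l; exact: (@discrete_mfun_big _ _ sM nat addn 0%N).
rewrite -sumEFin; apply: lee_sum => l _; rewrite mean_sum// -sumEFin.
apply: lee_sum => k _; rewrite mean_v -mulr_sumr EFinM.
apply: lee_wpmul2l; first by rewrite lee_fin; have /andP[] := B_itv hdrivers l j k.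
by rewrite mean_sum// -sumEFin; apply: lee_sum => r _; exact: mean_u.
Qed.

End Drivers.

(** * Construction of the stationary causal process *)

Theorem proposition1 (R : realType) (d : measure_display)
  (Omega : measurableType d) (P : probability Omega R) (m n p : nat)
  (hm : (1 <= m)%N) (hn : (1 <= n)%N) (hp : (1 <= p)%N)
  (Lambda : 'M[R]_(m, n)) (A : 'I_p -> 'M[R]_m) (B : 'I_p -> 'M[R]_n)
  (E : int -> {RV P >-> 'M[nat]_(m, n)})
  (U : int -> 'I_p -> 'I_m -> 'I_n -> 'I_m -> nat -> {RV P >-> bool})
  (V : int -> 'I_p -> 'I_m -> 'I_n -> 'I_n -> nat -> {RV P >-> bool})
  (hdrivers : matinar_drivers Lambda A B E U V)
  (hrho : spectral_radius (companion A B) < 1) :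
  exists Y : int -> {RV P >-> 'M[nat]_(m, n)},
    [/\ matinar_process E U V Y, strictly_stationary Y & causal E U V Y].
Proof.
have A0 l i k : 0 <= A l i k by case/andP: (A_itv hdrivers l i k).
have B0 l j k : 0 <= B l j k by case/andP: (B_itv hdrivers l j k).
have L0 i j : 0 <= Lambda i j.
  rewrite -lee_fin -(E_mean hdrivers 0) unlock; apply: integral_ge0 => w _.
  by rewrite lee_fin ler0n.
have [M M0 ME] := companion_fixpoint hp A0 B0 L0 hrho.
have meanM := mean_path_iter hdrivers M0 ME.
pose X := driver_realization E U V.
pose past t := [set x : driver_index m n p | x.1 <= t].
pose pastlt t := [set x : driver_index m n p | x.1 < t].
pose counting t := [set x : driver_index m n p | exists c, x = (t, Some c)].
pose y t w := path_solution (X w) t.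
have my t : discrete_mfun <<s \bigcup_(x in past t) driver_sigma E U V x >> (y t).
  exact: (discrete_mfun_drivers (discrete_mfun_path_solution (fun x xt => xt))).
have y_measurable t : measurable_fun setT (y t).
  by move=> _ C _; rewrite setTI; apply: drivers_sub_measurable; exact: my.
pose Y t : {RV P >-> 'M[nat]_(m, n)} :=
  HB.pack (y t) (isMeasurableFun.Build _ _ _ _ (y t) (y_measurable t)).
have Y_past t : sigma_rv (Y t) `<=` <<s \bigcup_(x in past t) driver_sigma E U V x >>.
  by move=> _ [C _ <-]; rewrite setTI; exact: my.
(* Values of the process before [t] depend only on drivers strictly before [t], so independence from
   the past reduces to disjointness of groups of drivers. *)
have past_sub t : past_sigma Y t `<=` <<s \bigcup_(x in pastlt t) driver_sigma E U V x >>.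
  move=> S [s /= st /Y_past]; apply: sub_sigma_algebra2.
  apply: bigcup_subset => x /= xs; exact: le_lt_trans xs st.
exists Y; split.
- split=> [t|t|t].
  (* The bounds must hold almost surely for all times and entries at once: these triples are
     countable, so coding them by [k] leaves countably many null sets. *)
  + have bounded : {ae P, forall w, forall c, exists K, forall N,
        (path_iter N (X w) c.1.1 c.1.2 c.2 <= K)%N}.
      have : {ae P, forall w, forall k, forall c, unpickle k = Some c -> exists K, forall N,
          (path_iter N (X w) c.1.1 c.1.2 c.2 <= K)%N}.
        apply: ae_foralln => k; case: unpickle => [[[s i] j]|]; last exact: aeW.
        apply: (filterS _ (@mean_ae_bounded _ _ _ P (fun N w => path_iter N (X w) s i j)
          (M i j) _ _ _)) => [w wb _ [<-]//|N|N w|N].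
        - apply: (@discrete_mfun_realization _ _ _ _ _ _ _ E U V _ setT
            (fun x => path_iter N x s i j)).
          apply: (discrete_mfun_comp (fun M : 'M[nat]_(m, n) => M i j)).
          exact: discrete_mfun_path_iter.
        - exact: path_iter_incr.
        - exact: meanM.
      by apply: filterS => w h c; apply: (h (pickle c)); rewrite pickleK.
    apply: filterS bounded => w wb; apply: path_solutionE => s i j.
    exact: (wb (s, i, j)).
  + apply: independent2_sub (drivers_independent_groups hdrivers
      (J := [set (t, None)]) (K := counting t `|` pastlt t) _).
    * by move=> S ES G [_]; apply; exists (t, None).
    * apply: smallest_sub; first exact: smallest_sigma_algebra.
      move=> S [[c _ cS]|/past_sub].
        by move=> G [_]; apply; exists (t, Some c) => //; left; exists c.
      by apply: sub_sigma_algebra2; apply: bigcup_subset => x xt; right.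
    * by apply/seteqP; split=> // _ [-> [[c]|]]//=; rewrite /pastlt/= ltxx.
  + apply: independent2_sub (drivers_independent_groups hdrivers
      (J := counting t) (K := pastlt t) _).
    * by apply: sub_sigma_algebra2 => S [c _ cS]; exists (t, Some c) => //; exists c.
    * by apply: smallest_sub; [exact: smallest_sigma_algebra|exact: past_sub].
    * by apply/seteqP; split=> // _ [[c ->]]; rewrite /pastlt/= ltxx.
- move=> k t h C.
  (* Only finitely many times [t r] enter, so the values form a countable space of finite functions,
     and any [C] gives a measurable set of paths. *)
  have mS : coordinate_sigma setT [set x : driver_path m n p | C (fun r => path_solution x (t r))].
    have := @discrete_mfun_ffun _ _ (@path_sigma_algebra m n p setT) 'I_k _
      (fun r x => path_solution x (t r)) (fun r => discrete_mfun_path_solution (fun x _ => I)).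
    move=> /(_ [set g | C (fun r => g r)]).
    rewrite (_ : _ @^-1` _ = [set x | C (fun r => path_solution x (t r))])//.
    have xE x : [ffun i => path_solution x (t i)] = (fun r => path_solution x (t r)) :> ('I_k -> _).
      by apply/funext => r; rewrite ffunE.
    by apply/seteqP; split=> x; rewrite /preimage/= xE.
  (* The law of the drivers is shift invariant, and solving along the shifted path gives the process
     at the times [t r + h]. *)
  rewrite -[RHS](path_law_shift hdrivers h mS); congr (P _).
  have wE w : (fun r => Y (t r + h) w) = (fun r => path_solution (path_shift h (X w)) (t r)).
    by apply/funext => r; rewrite path_solution_shift.
  by apply/seteqP; split=> w; rewrite /preimage/= wE.
- exact: Y_past.
Qed.
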